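(* Let $A$ be a complex unital Hermitian algebra, and let $\phi:A\to\mathbb{C}$ be a continuous spectrally multiplicative function, i.e. a continuous function (not assumed linear or multiplicative) satisfying $\phi(x)\phi(y)\in\sigma(xy)$ for all $x,y\in A$. Then either $\phi$ is a character of $A$ or $-\phi$ is a character of $A$.
   Context: A complex unital Hermitian algebra is a complex Banach algebra $A$ with identity $\mathbf{1}$ and an involution $x\mapsto x^\star$ (conjugate-linear, $(xy)^\star=y^\star x^\star$, $x^{\star\star}=x$; the involution is not assumed continuous, and $A$ is not assumed semisimple) such that every self-adjoint element ($x=x^\star$) has real spectrum. For $x\in A$, $\sigma(x)=\{\lambda\in\mathbb{C}:\lambda\mathbf{1}-x \text{ is not invertible in } A\}$ is the spectrum of $x$. Continuity of $\phi$ is with respect to the norm topology. A character of $A$ is a nonzero function $A\to\mathbb{C}$ that is both linear and multiplicative. *)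

(* Defs.v *)
From HB Require Import structures.
From mathcomp Require Import all_boot all_order all_algebra.
From mathcomp Require Import all_classical all_reals all_analysis.
From mathcomp Require Import complex.
Set Implicit Arguments.
Unset Strict Implicit.
Unset Printing Implicit Defensive.
Import Order.TTheory GRing.Theory Num.Theory.
Import numFieldNormedType.Exports.
Local Open Scope classical_set_scope.
Local Open Scope ring_scope.
Local Open Scope complex_scope.

(* MathComp's [numDomainType] already has a norm and a product, so a structure
   inheriting from both [normedModType] and [algType] is rejected by
   Hierarchy-Builder (missing join).  Banach algebras are therefore packaged by
   hand, and the carrier is given both structures, sharing their addition and
   scaling.  No normalization [`|1| = 1] is required. *)
Record banachAlgType (K : numFieldType) := BanachAlgType {
  banach_base : completeNormedModType K;
  banach_mul : banach_base -> banach_base -> banach_base;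
  banach_one : banach_base;
  banach_mulA : associative banach_mul;
  banach_mul1l : left_id banach_one banach_mul;
  banach_mul1r : right_id banach_one banach_mul;
  banach_mulDl : left_distributive banach_mul +%R;
  banach_mulDr : right_distributive banach_mul +%R;
  banach_one_neq0 : banach_one != 0;
  banach_scaleAl : forall (a : K) x y,
    a *: banach_mul x y = banach_mul (a *: x) y;
  banach_scaleAr : forall (a : K) x y,
    a *: banach_mul x y = banach_mul x (a *: y);
  banach_mul_norm : forall x y, `|banach_mul x y| <= `|x| * `|y|
}.

Definition banach_carrier (K : numFieldType) (A : banachAlgType K) : Type :=
  banach_base A.
Coercion banach_carrier : banachAlgType >-> Sortclass.

Section BanachInstances.
Variables (K : numFieldType) (A : banachAlgType K).

HB.instance Definition _ :=
  CompleteNormedModule.copy (banach_carrier A) (banach_base A).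
HB.instance Definition _ :=
  GRing.Zmodule_isNzRing.Build (banach_carrier A)
    (@banach_mulA K A) (@banach_mul1l K A) (@banach_mul1r K A)
    (@banach_mulDl K A) (@banach_mulDr K A) (@banach_one_neq0 K A).
HB.instance Definition _ :=
  GRing.Lmodule_isLalgebra.Build K (banach_carrier A) (@banach_scaleAl K A).
HB.instance Definition _ :=
  GRing.Lalgebra_isAlgebra.Build K (banach_carrier A) (@banach_scaleAr K A).

Lemma banach_normM (x y : A) : `|x * y| <= `|x| * `|y|.
Proof. exact: banach_mul_norm. Qed.

End BanachInstances.

Section Definitions.
Variables (R : realType) (A : banachAlgType R[i]).

Definition invertible (x : A) : Prop := exists y : A, x * y = 1 /\ y * x = 1.

Definition spectrum (x : A) : set R[i] := [set l | ~ invertible (l *: 1 - x)].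

(* Continuity of [star] is deliberately not included. *)
Record is_involution (star : A -> A) : Prop := IsInvolution {
  starD : forall x y, star (x + y) = star x + star y;
  starZ : forall (a : R[i]) x, star (a *: x) = Num.conj a *: star x;
  starM : forall x y, star (x * y) = star y * star x;
  starK : forall x, star (star x) = x
}.

Definition hermitian_involution (star : A -> A) : Prop :=
  forall x : A, star x = x -> forall l, spectrum x l -> l \is Num.real.

Definition spectrally_multiplicative (phi : A -> R[i]) : Prop :=
  forall x y : A, spectrum (x * y) (phi x * phi y).

Definition is_character (phi : A -> R[i]) : Prop :=
  [/\ exists x, phi x <> 0, scalar phi & {morph phi : x y / x * y}].

End Definitions.

(* Main.v *)
(* Up to sign [phi 1 = 1].  If [x] is invertible, [phi x *: y - phi y *: x] is singular
   for every [y]; in particular [phi] is homogeneous on invertible elements.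
   Call a selfadjoint [h] definite if [h + i k] is invertible for all selfadjoint
   [k].  Then [Re (phi (h + i k)) = phi h], and rotating [h + i k] by complex
   scalars makes [phi] affine along lines through definite elements.  Near [1],
   [phi] is Lipschitz and [1 + s k] is definite up to [O(s^2)], hence
   [k |-> Im (phi (1 + i k))] is additive; inverting [1 + i k] shows that it
   preserves squares.  Its complex linear extension [psi] is then a Jordan
   homomorphism to the complex numbers, hence a character.  Finally [phi y] is
   [0] or [psi y] for every [y], and continuity of [phi] along the segment from
   [y] to [psi y *: 1] excludes [0] when [psi y] is nonzero. *)
Require Import Defs.
From mathcomp Require Import all_boot all_order all_algebra.
From mathcomp Require Import all_classical all_reals all_analysis.
From mathcomp Require Import complex ring.
Import Order.TTheory GRing.Theory Num.Theory.
Import numFieldNormedType.Exports.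
Local Open Scope classical_set_scope.
Local Open Scope ring_scope.

(* Reflexive decision of identities in a noncommutative algebra: the difference
   of the two sides is expanded into a combination of words in the atoms, and
   one scalar equation per word is left. *)
Inductive ncexp (K : Type) : Type :=
  | NCvar of nat
  | NCzero
  | NCone
  | NCadd of ncexp K & ncexp K
  | NCopp of ncexp K
  | NCmul of ncexp K & ncexp K
  | NCscale of K & ncexp K.
Arguments NCvar {K} _.
Arguments NCzero {K}.
Arguments NCone {K}.
Arguments NCadd {K} _ _.
Arguments NCopp {K} _.
Arguments NCmul {K} _ _.
Arguments NCscale {K} _ _.

Section NCexp.
Variables (K : comNzRingType) (A : algType K) (env : seq A).

Fixpoint nceval (e : ncexp K) : A :=
  match e with
  | NCvar n => nth 0 env n
  | NCzero => 0
  | NCone => 1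
  | NCadd e1 e2 => nceval e1 + nceval e2
  | NCopp e1 => - nceval e1
  | NCmul e1 e2 => nceval e1 * nceval e2
  | NCscale c e1 => c *: nceval e1
  end.

Fixpoint ncterms (e : ncexp K) : seq (K * seq nat) :=
  match e with
  | NCvar n => [:: (1, [:: n])]
  | NCzero => [::]
  | NCone => [:: (1, [::])]
  | NCadd e1 e2 => ncterms e1 ++ ncterms e2
  | NCopp e1 => [seq (- t.1, t.2) | t <- ncterms e1]
  | NCmul e1 e2 =>
    [seq (s.1 * t.1, s.2 ++ t.2) | s <- ncterms e1, t <- ncterms e2]
  | NCscale c e1 => [seq (c * t.1, t.2) | t <- ncterms e1]
  end.

Definition ncword (w : seq nat) : A := \prod_(n <- w) nth 0 env n.

Lemma ncevalE e : nceval e = \sum_(t <- ncterms e) t.1 *: ncword t.2.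
Proof.
elim: e => [n|||e1 IH1 e2 IH2|e1 IH1|e1 IH1 e2 IH2|c e1 IH1] /=.
- by rewrite big_seq1 /= /ncword big_seq1 scale1r.
- by rewrite big_nil.
- by rewrite big_seq1 /= /ncword big_nil scale1r.
- by rewrite big_cat IH1 IH2.
- by rewrite big_map IH1 -sumrN; apply: eq_bigr => t _; rewrite scaleNr.
- rewrite big_allpairs_dep IH1 IH2 mulr_suml; apply: eq_bigr => s _.
  rewrite mulr_sumr; apply: eq_bigr => t _.
  by rewrite -scalerAl -scalerAr scalerA /ncword big_cat.
- by rewrite big_map IH1 scaler_sumr; apply: eq_bigr => t _; rewrite scalerA.
Qed.

Fixpoint nccoef (ts : seq (K * seq nat)) (w : seq nat) : K :=
  if ts is t :: ts' then
    if t.2 == w then t.1 + nccoef ts' w else nccoef ts' w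
  else 0.

Fixpoint all_nccoef0 (ts : seq (K * seq nat)) (ws : seq (seq nat)) : Prop :=
  if ws is w :: ws' then nccoef ts w = 0 /\ all_nccoef0 ts ws' else True.

Lemma nceval_eq e1 e2 :
    (let ts := ncterms (NCadd e1 (NCopp e2)) in
     all_nccoef0 ts (undup (map snd ts))) ->
  nceval e1 = nceval e2.
Proof.
move=> h; apply/eqP; rewrite -subr_eq0 -[_ - _]/(nceval (NCadd e1 (NCopp e2))).
move: h; rewrite ncevalE /=; set ts := (_ ++ _) => h.
have -> : \sum_(t <- ts) t.1 *: ncword t.2 =
    \sum_(w <- undup (map snd ts)) nccoef ts w *: ncword w.
  have coefE us w : nccoef us w = \sum_(t <- us | t.2 == w) t.1.
    by elim: us => [|u us IH] /=; rewrite ?big_nil// big_cons IH.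
  under [RHS]eq_bigr do rewrite coefE scaler_suml.
  rewrite (exchange_big_dep xpredT)//=; apply: eq_big_seq => t tts.
  rewrite big_mkcond (bigD1_seq t.2) ?undup_uniq ?mem_undup ?map_f//= eqxx.
  by rewrite big1 ?addr0// => w; rewrite eq_sym => /negPf ->.
apply/eqP; elim: (undup _) h => [|w ws IH] /=; first by rewrite big_nil.
by case=> h /IH hs; rewrite big_cons h scale0r add0r.
Qed.

End NCexp.

Ltac nc_index x env :=
  lazymatch env with
  | x :: _ => constr:(0%N)
  | _ :: ?env' => let n := nc_index x env' in constr:(n.+1)
  end.

Ltac nc_add x env :=
  match env with
  | _ => let _ := nc_index x env in env
  | _ => constr:(x :: env)
  end.

Ltac nc_atoms t env :=
  lazymatch t with
  | @Algebra.add _ ?x ?y => let env := nc_atoms x env in nc_atoms y env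
  | @GRing.mul _ ?x ?y => let env := nc_atoms x env in nc_atoms y env
  | @Algebra.opp _ ?x => nc_atoms x env
  | @GRing.scale _ _ _ ?x => nc_atoms x env
  | @GRing.one _ => env
  | @Algebra.zero _ => env
  | _ => nc_add t env
  end.

Ltac nc_reify K t env :=
  lazymatch t with
  | @Algebra.add _ ?x ?y =>
    let e := nc_reify K x env in let f := nc_reify K y env in
    constr:(@NCadd K e f)
  | @GRing.mul _ ?x ?y =>
    let e := nc_reify K x env in let f := nc_reify K y env in
    constr:(@NCmul K e f)
  | @Algebra.opp _ ?x => let e := nc_reify K x env in constr:(@NCopp K e)
  | @GRing.scale _ _ ?c ?x =>
    let e := nc_reify K x env in constr:(@NCscale K c e)
  | @GRing.one _ => constr:(@NCone K)
  | @Algebra.zero _ => constr:(@NCzero K)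
  | _ => let n := nc_index t env in constr:(@NCvar K n)
  end.

Ltac nc_ring_with K A :=
  rewrite ?expr2;
  lazymatch goal with
  | |- ?l = ?r =>
    let env := nc_atoms l (@nil A) in
    let env := nc_atoms r env in
    let e := nc_reify K l env in
    let f := nc_reify K r env in
    change (nceval _ _ env e = nceval _ _ env f)
  end;
  apply: nceval_eq; rewrite /=; repeat split.

Ltac nc_ring :=
  match goal with
  | R : realType, A : banachAlgType _ |- _ => nc_ring_with R[i] A
  end.

(** * Invertible elements and the Neumann series *)

Section Invertible.
Variables (R : realType) (A : banachAlgType R[i]).
Implicit Types x y : A.
(** Nonnegative elements of [R[i]] are real, so the bound comes from the archimedean property of
    [R]. *)
Lemma ge0_complex_half_pow_lt (K e : R[i]) : 0 <= K -> 0 < e ->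
  exists N, forall n, (N <= n)%N -> K / 2 ^+ n < e.
Proof.
move=> K0 e0.
have Kr : K = (complex.Re K)%:C%C by rewrite RRe_real// ger0_real.
have er : e = (complex.Re e)%:C%C by rewrite RRe_real// gtr0_real.
have re0 : 0 < complex.Re e by rewrite -ltcR -er.
exists (Num.Def.archi_bound (complex.Re K / complex.Re e)) => n nN.
have := upper_nthrootP nN; rewrite ltr_pdivrMr// -ltcR rmorphM rmorphXn/= -Kr -er.
rewrite rmorph_nat => h.
by rewrite ltr_pdivrMr ?exprn_gt0// mulrC.
Qed.

(** The factor [|1|] stays because the norm of the identity is not normalized. *)
Lemma norm_expr_half x n : `|x| <= 1 / 2 -> `|x ^+ n| <= `|1 : A| / 2 ^+ n.
Proof.
move=> x12; elim: n => [|n IHn]; first by rewrite expr0 divr1.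
rewrite !exprSr; apply: le_trans (banach_normM _ _) _.
by rewrite invfM mulrA -(div1r 2); exact: ler_pM.
Qed.

Lemma cauchy_series_expr x : `|x| <= 1 / 2 -> cauchy (series (fun i => x ^+ i) @ \oo).
Proof.
move=> x12; apply/cauchy_seriesP => e e0.
have [N hN] := ge0_complex_half_pow_lt (`|1 : A| * 2) e (mulr_ge0 (normr_ge0 _) (ler0n _ _)) e0.
exists ([set n | (N <= n)%N], [set n | (N <= n)%N]) => //=.
  by split; exists N.
move=> [m n] [/= Nm _].
apply: le_lt_trans (hN _ Nm).
(* Keeping the negative tail term makes the induction on the length of the sum close. *)
suff H : `|\sum_(m <= k < n) x ^+ k| <= `|1 : A| * 2 / 2 ^+ m - `|1 : A| * 2 / 2 ^+ (maxn m n).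
  by apply: le_trans H _; rewrite gerBl divr_ge0 ?mulr_ge0 ?exprn_ge0.
have [mn|nm] := leqP m n; last by rewrite big_geq ?normr0 ?subrr// ltnW.
rewrite -(subnKC mn); elim: (n - m)%N => [|d IHd].
  by rewrite addn0 big_geq// normr0 subrr.
rewrite addnS big_nat_recr ?leq_addr//=; apply: le_trans (ler_normD _ _) _.
apply: le_trans (lerD IHd (norm_expr_half _ (m + d) x12)) _.
rewrite [in leRHS]exprS invfM !mulrA mulfK// -addrA lerD2l.
by rewrite -mulrA mulrCA mulr_natl mulr2n opprD subrK.
Qed.

(** Neumann series: the limit [s] of the partial sums [S n] is the inverse, since
    [(1 - x) * S n = 1 - x ^+ n] and [x ^+ n] tends to 0. *)
Lemma invertible_1B x : `|x| <= 1 / 2 -> invertible (1 - x).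
Proof.
move=> x12; have /cauchy_cvg/cvg_ex[/= s hs] := cauchy_series_expr _ x12.
set S := series _ in hs.
have cS n : GRing.comm (1 - x) (S n).
  apply/commr_sym/commrB; first exact: commr1.
  by apply/commr_sym/commr_sum => i _; exact: commrX.
have tele n : (1 - x) * S n = 1 - x ^+ n.
  elim: n => [|n IHn]; first by rewrite /S seriesEnat/= big_geq// expr0 subrr mulr0.
  rewrite {1}/S seriesSr mulrDr IHn mulrBl mul1r -exprS.
  by rewrite addrA (@subrK A). 
have close e : 0 < e -> exists n, `|s - S n| < e /\ `|x ^+ n| < e.
  move=> e0; have [N hN] := ge0_complex_half_pow_lt _ _ (normr_ge0 (1 : A)) e0.
  move/cvgrPdist_lt: hs => /(_ e e0)[M _ hM].
  exists (maxn M N); split; first by apply: hM; rewrite /= leq_maxl.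
  by apply: le_lt_trans (norm_expr_half _ _ x12) (hN _ (leq_maxr _ _)).
exists s; split; apply/eqP; rewrite -subr_eq0 -normr_le0;
  apply/ler_addgt0Pl => e e0; rewrite addr0.
all: have K0 : 0 < `|1 - x| + 1 :> R[i] by rewrite ltr_wpDl.
all: have [n [n1 n2]] := close _ (divr_gt0 e0 K0).
  have -> : (1 - x) * s - 1 = (1 - x) * (s - S n) - x ^+ n.
    by rewrite mulrBr tele opprB -addrA addrAC subrr add0r.
  apply: le_trans (ler_normB _ _) _.
  apply: le_trans (lerD (banach_normM _ _) (ltW n2)) _.
  rewrite -[leRHS](divfK (lt0r_neq0 K0)) [leRHS]mulrDr mulr1 lerD2r mulrC.
  by rewrite ler_wpM2r// ltW.
have -> : s * (1 - x) - 1 = (s - S n) * (1 - x) - x ^+ n.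
  by rewrite mulrBl -cS tele opprB -addrA addrAC subrr add0r.
apply: le_trans (ler_normB _ _) _.
apply: le_trans (lerD (banach_normM _ _) (ltW n2)) _.
rewrite -[leRHS](divfK (lt0r_neq0 K0)) [leRHS]mulrDr mulr1 lerD2r.
by rewrite ler_wpM2r// ltW.
Qed.

Lemma invertible1 : invertible (1 : A).
Proof. by exists 1; rewrite mulr1. Qed.

Lemma invertibleM x y : invertible x -> invertible y -> invertible (x * y).
Proof.
move=> [x' [xx' x'x]] [y' [yy' y'y]]; exists (y' * x'); split.
  by rewrite mulrA -(mulrA x) yy' mulr1.
by rewrite mulrA -(mulrA y') x'x mulr1.
Qed.

Lemma invertibleZ (c : R[i]) x : c != 0 -> invertible x -> invertible (c *: x).
Proof.
move=> c0 [x' [xx' x'x]]; exists (c^-1 *: x').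
by rewrite -!scalerAl -!scalerAr !scalerA mulfV// mulVf// !scale1r.
Qed.

End Invertible.

(** * Selfadjoint and definite elements *)

Section Hermitian.
Variables (R : realType) (A : banachAlgType R[i]) (star : A -> A).
Hypotheses (star_inv : is_involution star) (star_herm : hermitian_involution star).
Implicit Types x y z h k : A.

Definition selfadjoint x := star x = x.

Lemma star1 : star 1 = 1.
Proof.
by have := starM star_inv (star 1) 1; rewrite mulr1 (starK star_inv) mulr1.
Qed.

Lemma selfadjoint1 : selfadjoint 1.
Proof. exact: star1. Qed.

Lemma selfadjointD x y : selfadjoint x -> selfadjoint y -> selfadjoint (x + y).
Proof. by move=> hx hy; rewrite /selfadjoint (starD star_inv) hx hy. Qed.

Lemma selfadjointZ (r : R[i]) x :
  r \is Num.real -> selfadjoint x -> selfadjoint (r *: x).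
Proof. by move=> hr hx; rewrite /selfadjoint (starZ star_inv) hx conj_Creal. Qed.

Lemma selfadjointN x : selfadjoint x -> selfadjoint (- x).
Proof. by move=> hx; rewrite -scaleN1r; apply: selfadjointZ => //; rewrite rpredN real1. Qed.

Lemma selfadjointB x y : selfadjoint x -> selfadjoint y -> selfadjoint (x - y).
Proof. by move=> hx hy; apply: selfadjointD => //; exact: selfadjointN. Qed.

Lemma selfadjoint_sqr x : selfadjoint x -> selfadjoint (x * x).
Proof. by move=> hx; rewrite /selfadjoint (starM star_inv) hx. Qed.

Lemma invertible_addZ (l : R[i]) x : selfadjoint x -> l \isn't Num.real ->
  invertible (x + l *: 1).
Proof.
move=> hx hl; have -> : x + l *: 1 = (-1) *: ((- l) *: 1 - x).
  by nc_ring; ring.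
apply: invertibleZ; first by rewrite oppr_eq0 oner_eq0.
apply: contrapT => /(star_herm x hx); rewrite rpredN; exact/negP.
Qed.

Lemma invertible_star x : invertible x -> invertible (star x).
Proof.
move=> [y [xy yx]]; exists (star y).
by rewrite -!(starM star_inv) xy yx star1.
Qed.

(* A substitute for "positive invertible": it is stable under congruence
   [star z * h * z] without square roots, which would be delicate here because
   the involution need not be continuous. *)
Definition definite h := selfadjoint h /\
  forall k, selfadjoint k -> invertible (h + 'i *: k).

Lemma definite_invertible h : definite h -> invertible h.
Proof.
move=> [_ /(_ 0)]; rewrite scaler0 addr0; apply.
by rewrite /selfadjoint -(scale0r 1) (starZ star_inv) conj_Creal// star1.
Qed.

Lemma definite1 : definite 1.
Proof.
split=> [|k hk]; first exact: selfadjoint1.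
have -> : 1 + 'i *: k = 'i *: (k + (- 'i) *: 1).
  by nc_ring; ring: (@sqrCi R[i]).
apply: invertibleZ; first exact: neq0Ci.
by apply: invertible_addZ => //; rewrite rpredN nonRealCi.
Qed.

Lemma definiteZ (r : R[i]) h : 0 < r -> definite h -> definite (r *: h).
Proof.
move=> r0 [hh ih]; have rR := gtr0_real r0; have r0' := lt0r_neq0 r0.
split=> [|k hk]; first exact: selfadjointZ.
have -> : r *: h + 'i *: k = r *: (h + 'i *: (r^-1 *: k)) by nc_ring; field.
by apply: invertibleZ => //; apply: ih; apply: selfadjointZ; rewrite ?rpredV.
Qed.

(** If [w] inverts [z], then [k = star z * (star w * k * w) * z] with [star w * k * w] selfadjoint,
    so [star z] and [z] factor out of the perturbed element. *)
Lemma definite_conj z h : invertible z -> definite h -> definite (star z * h * z).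
Proof.
move=> iz [hh ih]; split=> [|k hk].
  by rewrite /selfadjoint !(starM star_inv) (starK star_inv) hh mulrA.
have isz := invertible_star _ iz; have [w [zw wz]] := iz.
have szw : star z * star w = 1 by rewrite -(starM star_inv) wz star1.
have -> : star z * h * z + 'i *: k =
    star z * (h + 'i *: (star w * k * w)) * z.
  rewrite mulrDr mulrDl -scalerAr -scalerAl !mulrA szw mul1r.
  by rewrite -(mulrA k) wz mulr1.
apply: invertibleM => //; apply: invertibleM => //; apply: ih.
by rewrite /selfadjoint !(starM star_inv) (starK star_inv) hk mulrA.
Qed.

(** The element is [star z * 1 * z] for [z = 1 + w *: k], which is invertible because [w^-1] is not
    real. *)
Lemma definite_quadratic (w : R[i]) k : w \isn't Num.real -> selfadjoint k ->
  definite (1 + (w + Num.conj w) *: k + (w * Num.conj w) *: (k * k)).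
Proof.
move=> hw hk; have w0 : w != 0 by apply: contraNneq hw => ->; rewrite real0.
have iz : invertible (1 + w *: k).
  have -> : 1 + w *: k = w *: (k + w^-1 *: 1) by nc_ring; field.
  by apply: invertibleZ => //; apply: invertible_addZ; rewrite ?rpredV.
have := definite_conj _ _ iz definite1.
rewrite (starD star_inv) star1 (starZ star_inv) hk.
congr definite; nc_ring; ring.
Qed.
End Hermitian.

(** * First consequences of spectral multiplicativity *)

Section Functional.
Variables (R : realType) (A : banachAlgType R[i]) (star : A -> A).
Hypotheses (star_inv : is_involution star) (star_herm : hermitian_involution star).
Variable phi : A -> R[i].
Hypotheses (phi_cont : continuous (phi : A -> R[i]^o)).
Hypotheses (phi_mult : spectrally_multiplicative phi) (phi1 : phi 1 = 1).
Implicit Types x y z h k : A.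

Local Notation sa := (selfadjoint R A star).
Local Notation definite := (definite R A star).

Lemma spectrum1 (c : R[i]) : spectrum (1 : A) c -> c = 1.
Proof.
move=> hc; apply/eqP; rewrite -subr_eq0; apply: contrapT => /negP c1.
apply: hc; have -> : c *: 1 - 1 = (c - 1) *: (1 : A) by nc_ring; ring.
by apply: invertibleZ => //; exact: invertible1.
Qed.

Lemma phi_inverse x y : x * y = 1 -> phi x * phi y = 1.
Proof. by move=> xy; apply: spectrum1; rewrite -xy; exact: phi_mult. Qed.

(** Let [z] be the inverse of [x]. Since [phi x * phi z = 1], multiplying by [z] on the right and by
    the nonzero scalar [- phi z] gives [phi y * phi z - y * z], which is singular. *)
Lemma phi_singular x y : invertible x ->
  ~ invertible (phi x *: y - phi y *: x).
Proof.
move=> [z [xz zx]] hinv; have pxz := phi_inverse _ _ xz.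
have iz : invertible z by exists x.
have pz0 : - phi z != 0.
  by rewrite oppr_eq0; apply/eqP => pz; move/eqP: pxz; rewrite pz mulr0 eq_sym oner_eq0.
apply: (phi_mult y z).
have -> : (phi y * phi z) *: 1 - y * z = (- phi z) *: ((phi x *: y - phi y *: x) * z).
  rewrite mulrBl -!scalerAl xz scalerBr !scalerA.
  rewrite mulNr (mulrC (phi z)) pxz scaleN1r mulNr scaleNr opprK.
  by rewrite addrC mulrC.
by apply: invertibleZ => //; exact: invertibleM.
Qed.

Lemma phi_real x : sa x -> phi x \is Num.real.
Proof.
move=> hx; apply: (star_herm x hx); have := phi_mult x 1.
by rewrite phi1 !mulr1.
Qed.

(** For [y = c *: x] the singular element of [phi_singular] is a multiple of the invertible [x], so
    the scalar must vanish. *)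
Lemma phiZ (c : R[i]) x : invertible x -> phi (c *: x) = c * phi x.
Proof.
move=> ix; apply/eqP; rewrite -subr_eq0; apply: contrapT => /negP c1.
apply: (phi_singular x (c *: x) ix).
rewrite scalerA -scalerBl mulrC -opprB; apply: invertibleZ => //.
by rewrite oppr_eq0.
Qed.

(** With [d = phi h - phi (h + i k)] and [phi h] real, the singular combination is [Re d] times
    [h + i k'] for a selfadjoint [k'], as soon as [Re d] is nonzero; definiteness of [h] then gives
    a contradiction. *)
Lemma Re_phi h k : definite h -> sa k -> 'Re (phi (h + 'i *: k)) = phi h.
Proof.
move=> dh hk; have [hh ih] := dh; have hr := phi_real _ hh.
apply/eqP; rewrite -subr_eq0; apply: contrapT => /negP r0.
set d := phi h - phi (h + 'i *: k).
have dr : 'Re d = - ('Re (phi (h + 'i *: k)) - phi h).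
  by rewrite /d raddfB/= (Creal_ReP _ hr) opprB.
have {}r0 : 'Re d != 0 by rewrite dr oppr_eq0.
apply: (phi_singular h (h + 'i *: k)); first exact: (definite_invertible _ _ _ star_inv).
have -> : phi h *: (h + 'i *: k) - phi (h + 'i *: k) *: h =
    'Re d *: (h + 'i *: (('Re d)^-1 *: ('Im d *: h + phi h *: k))).
  have -> : phi (h + 'i *: k) = phi h - ('Re d + 'i * 'Im d).
    by rewrite -Crect /d subKr.
  by nc_ring; field.
apply: invertibleZ => //; apply: ih; apply: selfadjointZ => //.
  by rewrite rpredV Creal_Re.
by apply: selfadjointD => //; apply: selfadjointZ => //; exact: Creal_Im.
Qed.

Lemma Re_mul1i (s z : R[i]) : s \is Num.real ->
  'Re ((1 + 'i * s) * z) = 'Re z - s * 'Im z.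
Proof.
by move=> sr; rewrite ReM Re_rect ?Im_rect ?real1// mul1r.
Qed.

(* Multiply [h + i l] by [1 + i s]. *)
Lemma phi_rotate h k (s : R[i]) : definite h -> sa k -> s \is Num.real ->
  definite (h - s *: k) ->
  phi (h - s *: k) = phi h - s * 'Im (phi (h + 'i *: k)).
Proof.
move=> dh hk sr dhs; have [hh ih] := dh.
have := phiZ (1 + 'i * s) _ (ih _ hk).
have -> : (1 + 'i * s) *: (h + 'i *: k) = (h - s *: k) + 'i *: (k + s *: h).
  by nc_ring; ring: (@sqrCi R[i]).
move=> /(congr1 (fun c : R[i] => 'Re c)); rewrite Re_mul1i// !Re_phi//.
by apply: selfadjointD => //; exact: selfadjointZ.
Qed.

(** * The functional [tangent] and its real homogeneity *)

(* On selfadjoint elements this is the restriction of the character sought. *)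
Definition tangent k : R[i] := 'Im (phi (1 + 'i *: k)).

Lemma tangent_real k : tangent k \is Num.real.
Proof. exact: Creal_Im. Qed.

Lemma phi_1i k : sa k -> phi (1 + 'i *: k) = 1 + 'i * tangent k.
Proof.
move=> hk; rewrite [LHS]Crect Re_phi ?phi1//; exact: (definite1 _ _ _ star_inv star_herm).
Qed.

Lemma phi_ball x (e : R[i]) : 0 < e ->
  exists2 d, 0 < d & forall y, `|y - x| < d -> `|phi y - phi x| < e.
Proof.
move=> e0; have /cvgrPdist_lt/(_ e e0) := phi_cont x.
move=> /nbhs_normP[d /= d0 hd]; exists d => // y yx.
by rewrite distrC; apply: hd; rewrite /= distrC.
Qed.

Lemma phi_near2 x y d (e : R[i]) : 0 < e -> exists2 r, 0 < r &
  `|phi (x + (r * r) *: d) - phi x| < e /\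
  `|phi (y + (r * r) *: d) - phi y| < e.
Proof.
move=> e0; have [d1 d10 h1] := phi_ball x _ e0.
have [d2 d20 h2] := phi_ball y _ e0.
have i1 : 0 < d1^-1 by rewrite invr_gt0.
have i2 : 0 < d2^-1 by rewrite invr_gt0.
have n0 := normr_ge0 d.
(* [M >= 1] exceeds [|d|] divided by either radius, so [r = M^-1] gives [r * r * |d| <= M^-1 * |d|],
   below both radii. *)
pose M := (1 + d1^-1 + d2^-1) * (1 + `|d|).
have p0 : 0 < 1 + `|d| by rewrite ltr_pwDl.
have q0 : 0 < 1 + d1^-1 + d2^-1 by rewrite !addr_gt0.
have M0 : 0 < M by rewrite mulr_gt0.
have M1 : 1 <= M.
  have a1 : 1 <= 1 + d1^-1 + d2^-1 by rewrite -addrA lerDl addr_ge0// ltW.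
  have a2 : 1 <= 1 + `|d| by rewrite lerDl.
  by apply: le_trans a1 _; rewrite /M ler_peMr// ltW.
have key c : 0 < c -> c^-1 < 1 + d1^-1 + d2^-1 -> `|(M^-1 * M^-1) *: d| < c.
  move=> c0 hc; rewrite normrZ ger0_norm ?mulr_ge0 ?invr_ge0 ?(ltW M0)//.
  rewrite -mulrA; apply: (@le_lt_trans _ _ (M^-1 * `|d|)).
    by rewrite ler_piMl ?mulr_ge0 ?invr_ge0 ?(ltW M0)// invf_le1.
  rewrite mulrC ltr_pdivrMr// /M mulrA.
  apply: (@lt_le_trans _ _ (1 + `|d|)); first by rewrite ltrDr.
  rewrite ler_peMl ?(ltW p0)//.
  by rewrite -[leLHS](mulfV (lt0r_neq0 c0)) ler_pM2l// ltW.
exists M^-1; first by rewrite invr_gt0.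
split; [apply: h1|apply: h2]; rewrite addrC addKr.
  by apply: key => //; rewrite -addrA addrCA ltrDl addr_gt0.
by apply: key => //; rewrite ltrDr addr_gt0.
Qed.

Lemma norm_Im_le (z : R[i]) : `|'Im z| <= `|z|.
Proof.
have [h _] := leif_normC_Re_Creal ('i * z).
by rewrite ReMil normrN normrM normCi mul1r in h.
Qed.

Lemma nonreal_rect (a b : R[i]) : a \is Num.real -> b \is Num.real -> b != 0 ->
  a + 'i * b \isn't Num.real.
Proof.
by move=> ar br b0; apply/negP => /Creal_ImP; rewrite Im_rect//; exact/eqP.
Qed.

(** When [h = 1 + r^2 k^2] and [h - s k] are definite, [phi_rotate] computes [phi (h - s k)] along
    [k] and along [t k]. Comparing the two gives homogeneity at [h]; then [r] tends to 0. *)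
Lemma tangentZ (t : R[i]) k : t \is Num.real -> sa k ->
  tangent (t *: k) = t * tangent k.
Proof.
move=> tr hk; have [->|t0] := eqVneq t 0.
  rewrite scale0r mul0r /tangent scaler0 addr0 phi1; exact/Creal_ImP/real1.
have htk : sa (t *: k) by exact: selfadjointZ.
have main r : 0 < r -> 'Im (phi (1 + 'i *: (t *: k) + (r * r) *: (k * k))) =
    t * 'Im (phi (1 + 'i *: k + (r * r) *: (k * k))).
  move=> r0; have rr := gtr0_real r0; have r0' := lt0r_neq0 r0.
  pose h := 1 + (r * r) *: (k * k).
  have dh : definite h.
    have := definite_quadratic _ _ _ star_inv star_herm ('i * r) k.
    rewrite rmorphM/= conjCi (conj_Creal rr).
    have -> : 'i * r + - 'i * r = 0 by ring.
    have -> : 'i * r * (- 'i * r) = r * r by ring: (@sqrCi R[i]).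
    rewrite scale0r addr0; apply => //.
    by rewrite -[_ * _]add0r nonreal_rect// real0.
  (* The number [3/5 + 4/5 i] has modulus 1 and twice its real part is 6/5, so [h - s k] is again a
     definite quadratic with the same [k^2] term as [h]. *)
  pose s : R[i] := - (6 / 5 * r).
  have sr : s \is Num.real by rewrite rpredN !realM ?realV ?realn.
  have s0 : s != 0 by rewrite oppr_eq0 !mulf_neq0 ?invr_neq0 ?pnatr_eq0.
  have dhs : definite (h - s *: k).
    have := definite_quadratic _ _ _ star_inv star_herm ((3 / 5 + 'i * (4 / 5)) * r) k.
    rewrite rmorphM rmorphD rmorphM/= conjCi (conj_Creal rr).
    have cR (m n : nat) : Num.conj (m%:R / n%:R) = m%:R / n%:R :> R[i].
      by rewrite conj_Creal// realM ?realV ?realn.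
    rewrite !cR.
    have -> : (3 / 5 + 'i * (4 / 5)) * r + (3 / 5 + - 'i * (4 / 5)) * r = - s.
      by rewrite /s; field.
    have -> : (3 / 5 + 'i * (4 / 5)) * r * ((3 / 5 + - 'i * (4 / 5)) * r) = r * r.
      by field: (@sqrCi R[i]).
    rewrite scaleNr /h addrAC; apply => //.
    have -> : (3 / 5 + 'i * (4 / 5)) * r = 3 / 5 * r + 'i * (4 / 5 * r) by ring.
    by rewrite nonreal_rect ?realM ?realV ?realn// !mulf_neq0 ?invr_neq0 ?pnatr_eq0.
  have e1 := phi_rotate _ _ _ dh hk sr dhs.
  have sth : s *: k = (s / t) *: (t *: k) by rewrite scalerA divfK.
  have str : s / t \is Num.real by rewrite realM ?realV.
  have dhs' := dhs; rewrite sth in dhs'.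
  have := phi_rotate _ _ _ dh htk str dhs'.
  rewrite -sth e1 => /addrI/oppr_inj.
  rewrite !(addrAC 1 ((r * r) *: _)) => e2.
  have -> : 'Im (phi (1 + 'i *: (t *: k) + (r * r) *: (k * k))) =
      t / s * (s / t * 'Im (phi (1 + 'i *: (t *: k) + (r * r) *: (k * k)))).
    by field; rewrite t0 s0.
  by rewrite -e2; field.
apply/eqP; rewrite -subr_eq0 -normr_le0; apply/ler_addgt0Pl => e e0; rewrite addr0.
have T0 : 0 < 1 + `|t| by rewrite ltr_pwDl.
have [r r0 [h1 h2]] := phi_near2 (1 + 'i *: (t *: k)) (1 + 'i *: k) (k * k) _ (divr_gt0 e0 T0).
set u := phi _ - _ in h1; set v := phi _ - _ in h2.
have -> : tangent (t *: k) - t * tangent k = t * 'Im v - 'Im u.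
  by rewrite /u /v !raddfB/= main//  /tangent; ring.
apply: le_trans (ler_normB _ _) _; rewrite normrM.
rewrite -[leRHS](divfK (lt0r_neq0 T0)) [leRHS]mulrDr mulr1 addrC mulrC.
have hu := le_trans (norm_Im_le u) (ltW h1).
have hv := le_trans (norm_Im_le v) (ltW h2).
by apply: lerD => //; rewrite ler_wpM2r.
Qed.

(** * Norm bounds and a Lipschitz estimate near 1 *)

(** The factor 2 reflects the radius 1/2 in [invertible_1B]. *)
Lemma spectrum_bound (c : R[i]) x : ~ invertible (c *: 1 - x) -> `|c| <= 2 * `|x|.
Proof.
move=> hc; apply: contrapT => /negP; rewrite -real_ltNge ?realM ?normr_real ?realn//.
move=> xc; apply: hc.
have c0 : 0 < `|c| by apply: le_lt_trans xc; rewrite mulr_ge0.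
have c0' : c != 0 by rewrite -normr_gt0.
have -> : c *: 1 - x = c *: (1 - c^-1 *: x) by nc_ring; field.
apply: invertibleZ => //; apply: invertible_1B.
by rewrite normrZ normfV mulrC ler_pdivrMr// mul1r mulrC ler_pdivlMr// mulrC ltW.
Qed.

Lemma phi_norm_le x : `|phi x| <= 2 * `|x|.
Proof.
apply: spectrum_bound; have := phi_mult x 1.
by rewrite /spectrum/= phi1 !mulr1.
Qed.

(** By [phi_singular], [D = phi y - phi x] lies in the spectrum of [D (1 - x) + phi x (y - x)]. The
    spectral bound gives [|D| <= |D| / 2 + 4 (|1| + 1) |y - x|], and half of [|D|] is absorbed. *)
Lemma phi_lipschitz1 x y : `|x - 1| <= 1 / 4 ->
  `|phi y - phi x| <= 8 * (`|1 : A| + 1) * `|y - x|.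
Proof.
move=> x14; have p4 : (4 : R[i]) != 0 by rewrite pnatr_eq0.
have ix : invertible x.
  have -> : x = 1 - (1 - x) by nc_ring; ring.
  apply: invertible_1B; rewrite distrC; apply: le_trans x14 _.
  by rewrite !div1r lef_pV2 ?posrE// ler_nat.
have hs : ~ invertible ((phi y - phi x) *: 1 -
    ((phi y - phi x) *: (1 - x) + phi x *: (y - x))).
  move=> hi; apply: (phi_singular x y ix); move: hi.
  have -> : phi x *: y - phi y *: x = (-1) *: ((phi y - phi x) *: 1 -
    ((phi y - phi x) *: (1 - x) + phi x *: (y - x))) by nc_ring; ring.
  by apply: invertibleZ; rewrite oppr_eq0 oner_eq0.
have hx : `|x| <= `|1 : A| + 1.
  have -> : x = 1 + (x - 1) by nc_ring; ring.
  apply: le_trans (ler_normD _ _) _; rewrite lerD2l; apply: le_trans x14 _.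
  by rewrite div1r invf_le1 ?ler1n.
have h1 := spectrum_bound _ _ hs; set D := `|phi y - phi x| in h1 *.
have h2 : D <= D / 2 + (4 * (`|1 : A| + 1)) * `|y - x|.
  apply: le_trans h1 _.
  have -> : D / 2 + 4 * (`|1 : A| + 1) * `|y - x| =
    2 * (D * (1 / 4) + 2 * (`|1 : A| + 1) * `|y - x|) by field.
  rewrite ler_pM2l//; apply: le_trans (ler_normD _ _) _.
  have x14' : `|1 - x| <= 1 / 4 by rewrite distrC.
  rewrite !normrZ; apply: lerD; first exact: ler_wpM2l.
  apply: ler_wpM2r => //; apply: le_trans (phi_norm_le x) _.
  by rewrite ler_pM2l.
have -> : D = 2 * (D - D / 2) by field.
have -> : 8 * (`|1 : A| + 1) * `|y - x| = 2 * (4 * (`|1 : A| + 1) * `|y - x|).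
  by ring.
by rewrite ler_pM2l// lerBlDl.
Qed.

(** * Second-order expansions and additivity of [tangent] *)

(** This is [f s = O(s^2)] as [s] tends to 0 through positive reals. *)
Definition quadratically_small (f : R[i] -> R[i]) := exists K d : R[i],
  [/\ 0 <= K, 0 < d & forall s, 0 < s -> s < d -> `|f s| <= K * (s * s)].

Lemma quadratically_smallD f g : quadratically_small f ->
  quadratically_small g -> quadratically_small (fun s => f s + g s).
Proof.
move=> [K [d [K0 d0 hf]]] [L [e [L0 e0 hg]]].
have i1 : 0 < d^-1 by rewrite invr_gt0.
have i2 : 0 < e^-1 by rewrite invr_gt0.
exists (K + L), (d^-1 + e^-1)^-1; split.
- exact: addr_ge0.
- by rewrite invr_gt0 addr_gt0.
move=> s s0 hs; have hs' : d^-1 + e^-1 < s^-1.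
  by rewrite -[ltLHS]invrK ltf_pV2 ?posrE// invr_gt0 addr_gt0.
have sd : s < d.
  rewrite -ltf_pV2 ?posrE//; apply: lt_trans hs'; by rewrite ltrDl.
have se : s < e.
  rewrite -ltf_pV2 ?posrE//; apply: lt_trans hs'; by rewrite ltrDr.
apply: le_trans (ler_normD _ _) _; rewrite mulrDl; apply: lerD.
  exact: hf.
exact: hg.
Qed.

Lemma quadratically_smallN f : quadratically_small f ->
  quadratically_small (fun s => - f s).
Proof.
move=> [K [d [K0 d0 hf]]]; exists K, d; split=> // s s0 sd.
by rewrite normrN hf.
Qed.

Lemma quadratically_small_linear (D : R[i]) :
  quadratically_small (fun s => s * D) -> D = 0.
Proof.
move=> [K [d [K0 d0 hD]]]; apply/eqP; rewrite -normr_le0; apply: contrapT.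
move=> /negP; rewrite -real_ltNge ?normr_real ?real0// => D0.
have p0 : 0 < K + 1 + `|D| / d by rewrite ltr_pwDl// ?ltr_wpDl// divr_ge0// ltW.
(* This [s] is below [d] and satisfies [K * s < |D|], against the assumed bound. *)
pose s := `|D| / (K + 1 + `|D| / d).
have s0 : 0 < s by rewrite divr_gt0.
have sd : s < d.
  rewrite /s ltr_pdivrMr// mulrDr mulrCA mulfV ?lt0r_neq0// mulr1.
  by rewrite ltrDr mulr_gt0// ltr_wpDl.
have Ks : K * s < `|D|.
  rewrite /s mulrA ltr_pdivrMr// mulrC ltr_pM2l//.
  by rewrite -addrA ltrDl ltr_wpDr// divr_ge0// ltW.
by have := hD _ s0 sd; rewrite normrM (gtr0_norm s0) mulrCA ler_pM2l// lt_geF.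
Qed.

(* This is [star z * z] for [z = 1 + (1/2 + i) s k]. *)
Definition square_near1 (s : R[i]) k : A := 1 + s *: k + (5 / 4 * (s * s)) *: (k * k).

Lemma definite_square_near1 (s : R[i]) k : 0 < s -> sa k ->
  definite (square_near1 s k).
Proof.
move=> s0 hk; have sr := gtr0_real s0.
have := definite_quadratic _ _ _ star_inv star_herm (s / 2 + 'i * s) k.
rewrite rmorphD/= !rmorphM/= conjCi (conj_Creal sr) fmorphV/= rmorph_nat.
have -> : s / 2 + 'i * s + (s / 2 + - 'i * s) = s by field.
have -> : (s / 2 + 'i * s) * (s / 2 + - 'i * s) = 5 / 4 * (s * s).
  by field: (@sqrCi R[i]).
by apply => //; rewrite nonreal_rect ?realM ?realV ?realn ?lt0r_neq0.
Qed.

(** The term in [t] changes sign between [t = 1] and [t = -1], so adding the two expansions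
    eliminates it; [tangentD] rests on this. *)
Lemma phi_square_near1 h k (t : R[i]) : sa h -> sa k -> t \is Num.real ->
  `|t| = 1 ->
  quadratically_small (fun s => phi (square_near1 s (h + t *: k)) -
    (phi (square_near1 s h) + t * 'Im (phi (square_near1 s h + 'i *: (s *: k))))).
Proof.
move=> hh hk tr t1.
(* Multiplying by [1 - i t] a perturbation of order [s^2] of [x] below gives an
   element with real part [square_near1 s (h + t k)]. *)
set E := (h + t *: k) * (h + t *: k) - h * h.
pose M := 8 * (`|1 : A| + 1).
have M0 : 0 <= M by rewrite mulr_ge0// addr_ge0.
(* For [s <= 1], [s * C] bounds [|x - 1|]; the condition [s < (4 * (1 + C))^-1] brings it below 1/4,
   as [phi_lipschitz1] requires. *)
pose C := `|h| + 2 * `|h * h| + `|k|.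
have C0 : 0 <= C by rewrite !addr_ge0// mulr_ge0.
have C1 : 0 < 1 + C by rewrite ltr_pwDl.
exists (M * (2 * `|E|)), ((4 * (1 + C))^-1); split.
- by rewrite !mulr_ge0.
- by rewrite invr_gt0 mulr_gt0.
move=> s s0 sd; have sr := gtr0_real s0.
have s1 : s <= 1.
  apply: le_trans (ltW sd) _; rewrite invf_le1 ?mulr_gt0//.
  rewrite mulrDr mulr1; apply: (@le_trans _ _ 4); first by rewrite ler1n.
  by rewrite lerDl mulr_ge0.
set q := square_near1 s h.
set x := q + 'i *: (s *: k).
have x1 : `|x - 1| <= 1 / 4.
  have -> : x - 1 = s *: (h + (5 / 4 * s) *: (h * h) + 'i *: k).
    by rewrite /x /q /square_near1; nc_ring; ring.
  apply: (@le_trans _ _ (s * C)).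
    rewrite normrZ (gtr0_norm s0) ler_pM2l//.
    apply: le_trans (ler_normD _ _) _; rewrite normrZ normCi mul1r lerD2r.
    apply: le_trans (ler_normD _ _) _; rewrite normrZ lerD2l ler_wpM2r//.
    rewrite ger0_norm ?mulr_ge0 ?divr_ge0 ?(ltW s0)//.
    apply: (@le_trans _ _ (5 / 4)); first by rewrite ler_piMr ?divr_ge0.
    by rewrite ler_pdivrMr// -natrM ler_nat.
  have : s * (4 * (1 + C)) <= 1.
    by rewrite -ler_pdivlMr ?mulr_gt0// div1r ltW.
  rewrite ler_pdivlMr// => hs; apply: le_trans hs.
  by rewrite -mulrA ler_pM2l// mulrC ler_pM2l// lerDr.
have w0 : 1 - 'i * t != 0.
  have : 1 + 'i * - t \isn't Num.real.
    rewrite nonreal_rect ?rpredN ?real1// oppr_eq0.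
    by rewrite -normr_gt0 t1 ltr01.
  by rewrite mulrN; apply: contraNneq => ->; exact: real0.
pose d := (5 / 4 * (s * s) / (1 - 'i * t)) *: E.
pose Y := square_near1 s (h + t *: k) + 'i *: (s *: k - t *: q).
have Yxd : x + d = (1 - 'i * t)^-1 *: Y.
  have -> : x + d = (1 - 'i * t)^-1 *: ((1 - 'i * t) *: x + (5 / 4 * (s * s)) *: E).
    by rewrite /d; nc_ring; field.
  congr (_ *: _); rewrite /Y /x /q /E /square_near1.
  by nc_ring; ring: (@sqrCi R[i]).
have hY : sa (s *: k - t *: q).
  apply: selfadjointB => //; apply: selfadjointZ => //.
  by case: (definite_square_near1 s h s0 hh).
have dY : definite (square_near1 s (h + t *: k)).
  by apply: definite_square_near1 => //; apply: selfadjointD => //; exact: selfadjointZ.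
have e1 : 'Re ((1 - 'i * t) * phi (x + d)) = phi (square_near1 s (h + t *: k)).
  rewrite Yxd phiZ; last by case: dY => _; exact.
  by rewrite mulrA mulfV// mul1r Re_phi.
have e2 : phi q + t * 'Im (phi x) = 'Re ((1 - 'i * t) * phi x).
  rewrite -mulrN Re_mul1i ?rpredN// mulNr opprK /x Re_phi//.
    exact: definite_square_near1.
  exact: selfadjointZ.
rewrite e2 -e1 -raddfB/= -mulrBr.
apply: le_trans (leif_normC_Re_Creal _).1 _; rewrite normrM.
apply: le_trans (ler_wpM2l (normr_ge0 _) (phi_lipschitz1 _ _ x1)) _.
rewrite (addrC x) (@addrK A) -/M /d normrZ normrM normfV.
have n0 : `|1 - 'i * t| != 0 by rewrite normr_eq0.
rewrite (ger0_norm (_ : 0 <= 5 / 4 * (s * s))); last first.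
  by rewrite !mulr_ge0 ?divr_ge0 ?(ltW s0).
have -> : `|1 - 'i * t| * (M * (5 / 4 * (s * s) / `|1 - 'i * t| * `|E|)) =
  M * (5 / 4 * `|E|) * (s * s) by field.
rewrite ler_wpM2r ?mulr_ge0 ?(ltW s0)//; apply: ler_wpM2l => //.
by apply: ler_wpM2r => //; rewrite ler_pdivrMr// -natrM ler_nat.
Qed.

Lemma selfadjoint0 : sa 0.
Proof.
by have := selfadjointZ _ _ _ star_inv 0 _ (real0 _) (selfadjoint1 _ _ _ star_inv);
  rewrite scale0r.
Qed.

(** This is the expansion at [h = 0], [t = 1], where [tangent (s k) = s * tangent k]. *)
Lemma phi_square_near1_tangent k : sa k ->
  quadratically_small (fun s => phi (square_near1 s k) - (1 + s * tangent k)).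
Proof.
move=> hk; have := phi_square_near1 0 k 1 selfadjoint0 hk (real1 _) (normr1 _).
move=> [K [d [K0 d0 h]]]; exists K, d; split=> // s s0 sd.
have := h s s0 sd; rewrite scale1r add0r mul1r.
have -> : square_near1 s 0 = 1.
  by rewrite /square_near1 scaler0 mulr0 scaler0 !addr0.
rewrite phi1 phi_1i; last by apply: selfadjointZ => //; exact: gtr0_real.
have sr := gtr0_real s0.
by rewrite tangentZ// Im_rect ?real1// realM// tangent_real.
Qed.

(** Summing the expansions for [t = 1] and [t = -1] shows that [s] times the defect in Jensen's
    equation is [O(s^2)], so the defect is 0. Half sums and half differences turn Jensen's equation
    into additivity. *)
Lemma tangentD h k : sa h -> sa k -> tangent (h + k) = tangent h + tangent k.
Proof.
have jensen u v : sa u -> sa v -> tangent (u + v) + tangent (u - v) = 2 * tangent u.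
  move=> hu hv; apply/eqP; rewrite -subr_eq0; apply/eqP.
  have hp : sa (u + v) by exact: selfadjointD.
  have hm : sa (u - v) by exact: selfadjointB.
  have N1r : (-1 : R[i]) \is Num.real by rewrite rpredN real1.
  have q1 := phi_square_near1 u v 1 hu hv (real1 _) (normr1 _).
  have q2 := phi_square_near1 u v (-1) hu hv N1r (normrN1 _).
  have := quadratically_smallD _ _ (phi_square_near1_tangent _ hp)
    (phi_square_near1_tangent _ hm).
  move/quadratically_smallN/(quadratically_smallD _ _ (quadratically_smallD _ _ q1 q2)).
  have qu := phi_square_near1_tangent _ hu.
  move/(quadratically_smallD _ _ (quadratically_smallD _ _ qu qu)).
  rewrite scale1r scaleN1r => hq; apply: quadratically_small_linear.
  move: hq; congr quadratically_small; apply: funext => s /=; ring.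
move=> hh hk; have hr : (2^-1 : R[i]) \is Num.real by rewrite realV realn.
have := jensen (2^-1 *: (h + k)) (2^-1 *: (h - k)).
rewrite tangentZ//; last exact: selfadjointD.
rewrite mulrA mulfV ?pnatr_eq0// mul1r => <-.
- by congr (tangent _ + tangent _); nc_ring; field.
- by apply: selfadjointZ => //; exact: selfadjointD.
- by apply: selfadjointZ => //; exact: selfadjointB.
Qed.

(** * Values of [tangent] on definite elements and on squares *)

(** Multiply [1 + i h] by [- i] and compare real parts: [h - i] on one side, [tangent h - i] on the
    other. *)
Lemma tangent_definite h : definite h -> tangent h = phi h.
Proof.
move=> dh; have [hh _] := dh; have [h1 i1] := definite1 _ _ _ star_inv star_herm.
have := phiZ (- 'i) _ (i1 _ hh); rewrite phi_1i//.
have -> : - 'i *: (1 + 'i *: h) = h + 'i *: - 1.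
  by nc_ring; ring: (@sqrCi R[i]).
move=> /(congr1 (fun c : R[i] => 'Re c)); rewrite Re_phi//; last exact: selfadjointN.
move=> ->; have -> : - 'i * (1 + 'i * tangent h) = tangent h + 'i * (-1).
  by ring: (@sqrCi R[i]).
by rewrite Re_rect ?tangent_real// rpredN real1.
Qed.

Lemma tangent1 : tangent 1 = 1.
Proof. by rewrite tangent_definite// ; exact: definite1. Qed.

Lemma definite_1sqr h : sa h -> definite (1 + h * h).
Proof.
move=> hh; have := definite_quadratic _ _ _ star_inv star_herm 'i h.
rewrite conjCi subrr scale0r addr0.
have -> : 'i * - 'i = 1 :> R[i] by ring: (@sqrCi R[i]).
by rewrite scale1r; apply => //; exact: nonRealCi.
Qed.

(* [(1 + i h)^-1] has real part [(1 + h^2)^-1]. *)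
Lemma tangent_sqr h : sa h -> tangent (h * h) = tangent h * tangent h.
Proof.
move=> hh; set g := tangent h; have gr : g \is Num.real by exact: tangent_real.
have [h1 i1] := definite1 _ _ _ star_inv star_herm.
have [y [xy yx]] := i1 _ hh; set x := 1 + 'i *: h in xy yx.
have sx : star x = 1 - 'i *: h.
  by rewrite /x (starD star_inv) h1 (starZ star_inv) hh conjCi scaleNr.
have syx : star y * star x = 1 by rewrite -(starM star_inv) xy h1.
have pxy := phi_inverse _ _ xy.
(* Writing [y = star y * star x * y] exhibits the real part [star y * y], definite by congruence,
   which is also the inverse of [x * star x = 1 + h^2]. *)
have yE : y = star y * 1 * y + 'i *: (- (star y * h * y)).
  transitivity (star y * star x * y); first by rewrite syx mul1r.
  by rewrite sx; nc_ring; ring.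
have iy : invertible y by exists x.
have dyy := definite_conj _ _ _ star_inv y 1 iy (definite1 _ _ _ star_inv star_herm).
have sh : sa (- (star y * h * y)).
  apply: selfadjointN => //.
  by rewrite /selfadjoint !(starM star_inv) (starK star_inv) hh mulrA.
have := Re_phi _ _ dyy sh; rewrite -yE => Rey.
have p1 : phi (star y * 1 * y) * phi (1 + h * h) = 1.
  apply: phi_inverse.
  have -> : 1 + h * h = x * star x.
    by rewrite sx /x; nc_ring; ring: (@sqrCi R[i]).
  rewrite mulr1 mulrA -(mulrA (star y)) yx mulr1 syx //.
have n0 : 1 + g * g != 0.
  apply: lt0r_neq0; rewrite ltr_pwDl// -expr2 real_exprn_even_ge0//.
(* From [phi x = 1 + i g]; the real part [(1 + g^2)^-1] is then [phi (star y * y)], the inverse of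
   [phi (1 + h^2)]. *)
have py : phi y = (1 + g * g)^-1 + 'i * (- g / (1 + g * g)).
  apply: (@mulfI _ (phi x)).
    by apply: contra_eq_neq pxy => ->; rewrite mul0r eq_sym oner_neq0.
  rewrite pxy /x phi_1i// -/g.
  by field: (@sqrCi R[i]).
have : phi (1 + h * h) = 1 + g * g.
  apply: (@mulfI _ (phi (star y * 1 * y))).
    by apply: contra_eq_neq p1 => ->; rewrite mul0r eq_sym oner_neq0.
  by rewrite p1 -Rey py Re_rect ?mulVf// ?realM ?realV ?realD ?realM ?rpredN ?real1.
rewrite -tangent_definite; last exact: definite_1sqr.
rewrite tangentD// ?tangent1; last exact: selfadjoint_sqr.
by move/addrI.
Qed.

(** * The complex linear extension [psi] and its multiplicativity *)

Definition re_part x : A := 2^-1 *: (x + star x).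
Definition im_part x : A := (- 'i / 2) *: (x - star x).

Lemma re_part_sa x : sa (re_part x).
Proof.
rewrite /selfadjoint /re_part (starZ star_inv) (starD star_inv) (starK star_inv).
by rewrite addrC fmorphV/= rmorph_nat.
Qed.

Lemma starN x : star (- x) = - star x.
Proof. by rewrite -scaleN1r (starZ star_inv) rmorphN1 scaleN1r. Qed.

Lemma im_part_sa x : sa (im_part x).
Proof.
rewrite /selfadjoint /im_part (starZ star_inv) (starD star_inv) starN.
rewrite (starK star_inv) rmorphM/= rmorphN/= conjCi fmorphV/= rmorph_nat.
by nc_ring; ring.
Qed.

Lemma re_im_part x : x = re_part x + 'i *: im_part x.
Proof. by rewrite /re_part /im_part; nc_ring; field: (@sqrCi R[i]). Qed.

Lemma re_partD x y : re_part (x + y) = re_part x + re_part y.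
Proof. by rewrite /re_part (starD star_inv); nc_ring; ring. Qed.

Lemma im_partD x y : im_part (x + y) = im_part x + im_part y.
Proof. by rewrite /im_part (starD star_inv); nc_ring; ring. Qed.

Lemma re_partZ (a : R[i]) x :
  re_part (a *: x) = 'Re a *: re_part x + (- 'Im a) *: im_part x.
Proof.
rewrite /re_part /im_part (starZ star_inv) [in LHS](Crect a).
rewrite rmorphD rmorphM/= conjCi !conj_Creal ?Creal_Re ?Creal_Im//.
by nc_ring; ring: (@sqrCi R[i]).
Qed.

Lemma im_partZ (a : R[i]) x :
  im_part (a *: x) = 'Re a *: im_part x + 'Im a *: re_part x.
Proof.
rewrite /re_part /im_part (starZ star_inv) [in LHS](Crect a).
rewrite rmorphD rmorphM/= conjCi !conj_Creal ?Creal_Re ?Creal_Im//.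
by nc_ring; ring: (@sqrCi R[i]).
Qed.

Definition psi x : R[i] := tangent (re_part x) + 'i * tangent (im_part x).

Lemma Re_psi x : 'Re (psi x) = tangent (re_part x).
Proof. by rewrite Re_rect// tangent_real. Qed.

Lemma psiD x y : psi (x + y) = psi x + psi y.
Proof.
rewrite /psi re_partD im_partD !tangentD; do 1?[exact: re_part_sa|exact: im_part_sa].
by ring.
Qed.

Lemma psiZ (a : R[i]) x : psi (a *: x) = a * psi x.
Proof.
have hr := re_part_sa x; have hi := im_part_sa x.
have ar := Creal_Re a; have ai := Creal_Im a; have an : - 'Im a \is Num.real by rewrite rpredN.
have sZ (r : R[i]) h : r \is Num.real -> sa h -> sa (r *: h).
  by move=> rr hh; exact: selfadjointZ.
rewrite /psi re_partZ im_partZ.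
rewrite (tangentD _ _ (sZ _ _ ar hr) (sZ _ _ an hi)).
rewrite (tangentD _ _ (sZ _ _ ar hi) (sZ _ _ ai hr)).
rewrite (tangentZ _ _ ar hr) (tangentZ _ _ an hi) (tangentZ _ _ ar hi) (tangentZ _ _ ai hr).
by rewrite [in RHS](Crect a); ring: (@sqrCi R[i]).
Qed.

Lemma psiN x : psi (- x) = - psi x.
Proof. by rewrite -scaleN1r psiZ mulN1r. Qed.

Lemma psi_sa h : sa h -> psi h = tangent h.
Proof.
move=> hh; rewrite /psi /re_part /im_part hh subrr scaler0.
have -> : 2^-1 *: (h + h) = h by nc_ring; field.
have := tangentZ 0 _ (real0 _) hh; rewrite scale0r mul0r => ->.
by rewrite mulr0 addr0.
Qed.

Lemma psi1 : psi 1 = 1.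
Proof. by rewrite psi_sa ?tangent1//; exact: selfadjoint1. Qed.

Lemma psi_sqr x : psi (x * x) = psi x * psi x.
Proof.
have hr := re_part_sa x; have hi := im_part_sa x.
rewrite [in LHS](re_im_part x) {2 3}/psi.
set h := re_part x in hr *; set k := im_part x in hi *.
have hs : sa (h + k) by exact: selfadjointD.
(* The cross term [h k + k h] becomes [(h + k)^2 - h^2 - k^2], so only squares of selfadjoint
   elements occur. *)
have -> : (h + 'i *: k) * (h + 'i *: k) =
    h * h + (- (k * k) + 'i *: ((h + k) * (h + k) + (- (h * h) - k * k))).
  by nc_ring; ring: (@sqrCi R[i]).
rewrite !(psiD, psiZ, psiN) !psi_sa ?tangent_sqr ?tangentD//; try exact: selfadjoint_sqr.
by ring: (@sqrCi R[i]).
Qed.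

Lemma psi_jordan x y : psi (x * y + y * x) = 2 * psi x * psi y.
Proof.
have -> : x * y + y * x = (x + y) * (x + y) + (- (x * x) - y * y) by nc_ring; ring.
by rewrite !(psiD, psiN) !psi_sqr psiD; ring.
Qed.

(** The square of [x y - y x] is a combination of the Jordan product of [x] with [y x y] and the
    square of that of [x] with [y]; [psi] kills both. Since [psi (y x) = - u], this says
    [(2 u)^2 = 0]. *)
Lemma psi_mul_ker x y : psi x = 0 -> psi (x * y) = 0.
Proof.
move=> x0; set u := psi (x * y).
have yx : psi (y * x) = - u.
  by have /eqP := psi_jordan x y; rewrite psiD x0 mulr0 mul0r addrC addr_eq0 => /eqP.
have /eqP : psi ((x * y - y * x) * (x * y - y * x)) = 0.
  have -> : (x * y - y * x) * (x * y - y * x) =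
      2 *: (x * (y * x * y) + (y * x * y) * x)
      - (x * y + y * x) * (x * y + y * x) by nc_ring; ring.
  rewrite psiD psiN psiZ psi_sqr !psi_jordan x0; ring.
rewrite psi_sqr psiD psiN yx opprK -mulr2n -/u mulf_eq0 orbb mulrn_eq0 /=.
by move/eqP.
Qed.

Lemma psiM x y : psi (x * y) = psi x * psi y.
Proof.
have : psi ((x - psi x *: 1) * y) = 0.
  by apply: psi_mul_ker; rewrite psiD psiN psiZ psi1 mulr1 subrr.
rewrite mulrBl -scalerAl mul1r psiD psiN psiZ => /eqP.
by rewrite subr_eq0 => /eqP.
Qed.

(** * The dichotomy between 0 and [psi] *)

(* With [m = phi y], [l = psi y] and [w] selfadjoint in the kernel of [psi], the
   element [x = 1 + i t w^2] has [phi x = 1], so [y - m x] is singular; if [m] is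
   neither [0] nor [l], then [w] and the real number [t] can be chosen so that a
   multiple of [y - m x] has a real part which is a definite quadratic
   polynomial in [w]. *)
Lemma phi_eq0_or_psi y : phi y = 0 \/ phi y = psi y.
Proof.
have [|m0] := eqVneq (phi y) 0; [by left | right].
apply/eqP; apply: contrapT => /negP ml.
set m := phi y in m0 ml; set l := psi y in ml.
pose g := l - m; have g0 : g != 0 by rewrite subr_eq0 eq_sym.
(* The sign [s] is chosen to make [Re b >= 0], for [b = - i s m / g]. *)
have [s [sr s2 Rb]] : exists s : R[i],
    [/\ s \is Num.real, s * s = 1 & 0 <= 'Re (s * (- 'i * (m / g)))].
  have [h|] := boolP (0 <= 'Re (- 'i * (m / g))).
    by exists 1; split; rewrite ?real1 ?mul1r.
  rewrite -real_ltNge ?real0 ?Creal_Re// => h.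
  exists (-1); split; rewrite ?rpredN ?real1//; first by ring.
  by rewrite mulN1r raddfN/= oppr_ge0 ltW.
set b := s * _ in Rb.
have s0 : s != 0 by apply: contra_eq_neq s2 => ->; rewrite mul0r eq_sym oner_neq0.
have b0 : b != 0.
  by rewrite /b !mulf_neq0 ?invr_neq0 ?oppr_eq0 ?neq0Ci.
(* With this [c], [r0 = 1 + Re b] is at least 1 and [r1 = Re b + |b|^2] is positive. *)
pose c := 1 + Num.conj b; pose r0 := 'Re c; pose r1 := 'Re (b * c).
have r01 : 1 <= r0.
  by rewrite /r0 /c raddfD/= Re_conj (Creal_ReP _ (real1 _)) lerDl.
have r0p : 0 < r0 by exact: lt_le_trans r01.
have r0n := lt0r_neq0 r0p.
have r1p : 0 < r1.
  have Rbb : 'Re (`|b| ^+ 2) = `|b| ^+ 2 by apply/Creal_ReP; rewrite realX.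
  rewrite /r1 /c mulrDr mulr1 -normCK raddfD/= Rbb.
  by rewrite ltr_wpDl// exprn_gt0// normr_gt0.
have r1n := lt0r_neq0 r1p.
pose y0 := g^-1 *: (y - l *: 1).
have py0 : psi (c *: y0) = 0.
  by rewrite !psiZ psiD psiN psiZ psi1 mulr1 subrr !mulr0.
pose w := re_part (c *: y0); have hw : sa w by exact: re_part_sa.
have tw : tangent w = 0.
  by rewrite /w -Re_psi py0; apply/Creal_ReP; exact: real0.
(* [K * r1] must be the [w^2] coefficient of [r0 *: h] below, where [h] is the definite quadratic
   with parameter [(2 r0)^-1 + i]. *)
pose K := r0 * ((2 * r0)^-1 * (2 * r0)^-1 + 1) / r1.
have Kr : K \is Num.real.
  by rewrite !realM ?realD ?realM ?realV ?realM ?realn ?real1 ?gtr0_real.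
have hp : sa (w * w) by exact: selfadjoint_sqr.
have hkp : sa ((s * K) *: (w * w)) by apply: selfadjointZ => //; exact: realM.
pose x := 1 + 'i *: ((s * K) *: (w * w)).
have ix : invertible x by have [_] := definite1 _ _ _ star_inv star_herm; exact.
have px : phi x = 1.
  rewrite /x (phi_1i _ hkp) (tangentZ _ _ (realM sr Kr) hp) (tangent_sqr _ hw).
  by rewrite tw !mulr0 addr0.
apply: (phi_singular x y ix); rewrite px -/m.
pose v := im_part (c *: y0) + 'Im c *: 1 + (K * 'Im (b * c)) *: (w * w).
have hv : sa v.
  apply: selfadjointD => //; last by apply: selfadjointZ => //; rewrite realM// Creal_Im.
  apply: selfadjointD => //; first exact: im_part_sa.
  by apply: selfadjointZ => //; exact: selfadjoint1.
pose h := 1 + r0^-1 *: w + ((2 * r0)^-1 * (2 * r0)^-1 + 1) *: (w * w).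
have dh : definite (r0 *: h).
  apply: definiteZ => //.
  have := definite_quadratic _ _ _ star_inv star_herm ((2 * r0)^-1 + 'i * 1) w.
  have rr : (2 * r0)^-1 \is Num.real by rewrite realV realM ?realn ?gtr0_real.
  rewrite rmorphD rmorphM/= conjCi rmorph1 (conj_Creal rr).
  have -> : (2 * r0)^-1 + 'i * 1 + ((2 * r0)^-1 + - 'i * 1) = r0^-1 by field.
  have -> : ((2 * r0)^-1 + 'i * 1) * ((2 * r0)^-1 + - 'i * 1) =
      (2 * r0)^-1 * (2 * r0)^-1 + 1 by field: (@sqrCi R[i]).
  by apply => //; rewrite nonreal_rect ?real1 ?oner_neq0.
have main : (c / g) *: (1 *: y - m *: x) = r0 *: h + 'i *: v.
  have cE : c = r0 + 'i * 'Im c by exact: Crect.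
  have bcE : b * c = r1 + 'i * 'Im (b * c) by exact: Crect.
  (* This is [y - m x = g (y0 + 1 + K b w^2)] multiplied by [c / g]. *)
  have -> : (c / g) *: (1 *: y - m *: x) =
      c *: y0 + c *: 1 + (K * (b * c)) *: (w * w).
    rewrite /y0 /x /b.
    have -> : l = g + m by rewrite subrK.
    by nc_ring; field: (@sqrCi R[i]) s2.
  rewrite {1}(re_im_part (c *: y0)) -/w {2}cE bcE /v /h /K.
  by nc_ring; field; first [done | exact: r0n | apply/andP; split; [exact: r1n | exact: r0n]].
have : invertible (r0 *: h + 'i *: v) by case: dh => _; exact.
rewrite -main.
have cg0 : c / g != 0.
  rewrite mulf_neq0 ?invr_neq0//; apply: contraNneq r0n => c0.
  by rewrite /r0 c0; apply/eqP/Creal_ReP; exact: real0.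
move=> /(invertibleZ _ _ _ _ (invr_neq0 cg0)); rewrite scalerA mulVf// scale1r.
by rewrite !scale1r.
Qed.

(** * The segment from [x] to [psi x *: 1] and the equality of [phi] and [psi] *)

Definition psi_path x (t : R) : A := x + t%:C%C *: (psi x *: 1 - x).

Lemma psi_psi_path x t : psi (psi_path x t) = psi x.
Proof. by rewrite /psi_path !(psiD, psiZ, psiN) psi1; ring. Qed.

Lemma norm_real_complex (t : R) : `|t%:C%C| = `|t|%:C%C :> R[i].
Proof.
have [t0|t0] := lerP 0 t.
  have t0' : (0 : R[i]) <= t%:C%C by move: t0; rewrite -lecR.
  by rewrite !ger0_norm.
have t0' : t%:C%C < (0 : R[i]) by move: t0; rewrite -ltcR.
by rewrite !ltr0_norm// rmorphN.
Qed.

(** Along the path [phi] takes only the values 0 and [psi x], which are [|psi x|] apart, so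
    continuity rules out a jump nearby. *)
Lemma phi_psi_path_locally_constant x t : psi x != 0 ->
  \forall u \near t, phi (psi_path x u) = phi (psi_path x t).
Proof.
move=> p0; set e := `|psi x|; have e0 : 0 < e by rewrite normr_gt0.
have [d d0 hd] := phi_ball (psi_path x t) _ e0.
set n := `|psi x *: 1 - x|.
have n0 : 0 < 1 + n by rewrite ltr_pwDl//; exact: normr_ge0.
have dn0 : 0 < d / (1 + n) by rewrite divr_gt0.
have dnE : d / (1 + n) = (complex.Re (d / (1 + n)))%:C%C.
  by rewrite RRe_real// gtr0_real.
have r0 : 0 < complex.Re (d / (1 + n)) by rewrite -ltcR -dnE.
apply/nbhs_normP; exists (complex.Re (d / (1 + n))) => // u /= tu.
have close : `|phi (psi_path x u) - phi (psi_path x t)| < e.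
  apply: hd; rewrite /psi_path.
  have -> : x + u%:C%C *: (psi x *: 1 - x) - (x + t%:C%C *: (psi x *: 1 - x)) =
      (u - t)%:C%C *: (psi x *: 1 - x) by rewrite rmorphB; nc_ring; ring.
  rewrite normrZ norm_real_complex -/n.
  have : (`|u - t|)%:C%C < d / (1 + n) by rewrite dnE ltcR distrC.
  rewrite ltr_pdivlMr//; apply: le_lt_trans.
  by rewrite ler_wpM2l ?lerDr// lecR.
have pe v : phi (psi_path x v) = 0 \/ phi (psi_path x v) = psi x.
  by rewrite -(psi_psi_path x v); exact: phi_eq0_or_psi.
case: (pe u) (pe t) close => -> [] -> //.
  by rewrite sub0r normrN ltxx.
by rewrite subr0 ltxx.
Qed.

Lemma phi_eq_psi x : phi x = psi x.
Proof.
have [p0|//] := phi_eq0_or_psi x.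
have [p|p] := eqVneq (psi x) 0; first by rewrite p0 p.
(* If [phi x = 0] while [psi x] is nonzero, this locally constant indicator goes from 1 to 0, and
   the intermediate value theorem would give it the value 1/2. *)
pose f (t : R) : R := (phi (psi_path x t) == 0)%:R.
have cf : continuous f.
  move=> t; apply: cvg_near_cst; apply: filterS (phi_psi_path_locally_constant x t p).
  by move=> u; rewrite /f => ->.
have f0 : f 0 = 1 by rewrite /f /psi_path scale0r addr0 p0 eqxx.
have f1 : f 1 = 0.
  rewrite /f /psi_path scale1r addrC subrK.
  by rewrite phiZ ?phi1 ?mulr1 ?(negbTE p)//; exact: invertible1.
have [|||c _] := @IVT R f 0 1 2^-1 => //.
- exact: continuous_subspaceT.
- by rewrite f0 f1 minEle maxEle ler10 /= invr_ge0 invf_le1// ?ler0n ?ler1n.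
rewrite /f; case: (phi _ == 0) => /eqP; first by rewrite eq_sym invr_eq1 pnatr_eq1.
by rewrite eq_sym invr_eq0 pnatr_eq0.
Qed.

Lemma phi_character : is_character phi.
Proof.
split; first by exists 1; rewrite phi1; apply/eqP; exact: oner_neq0.
- by move=> a x y; rewrite !phi_eq_psi psiD psiZ.
- by move=> x y; rewrite !phi_eq_psi psiM.
Qed.

End Functional.

(** * Reduction to the normalization [phi 1 = 1] *)

Local Open Scope complex_scope.

(* [R[i]^o] is [R[i]] with the topology given by its absolute value. *)
Theorem corollary3p9 (R : realType) (A : banachAlgType R[i]) (star : A -> A)
    (star_inv : is_involution star) (star_herm : hermitian_involution star)
    (phi : A -> R[i])
    (phi_cont : continuous (phi : A -> R[i]^o))
    (phi_mult : spectrally_multiplicative phi) :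
  is_character phi \/ is_character (fun x => - phi x).
Proof.
(* The square of [phi 1] lies in the spectrum of 1; if [phi 1 = -1], the normalized case is applied
   to [- phi]. *)
have : phi 1 ^+ 2 == 1.
  apply/eqP/(spectrum1 R A); have := phi_mult 1 1.
  by rewrite mulr1 expr2.
rewrite sqrf_eq1 => /orP[/eqP p1|/eqP p1]; [left | right].
  exact: (phi_character R A star star_inv star_herm phi phi_cont phi_mult p1).
apply: (phi_character R A star star_inv star_herm).
- by move=> x; apply: (@cvgN _ R[i]^o); exact: phi_cont.
- by move=> x y; rewrite mulrNN; exact: phi_mult.
- by rewrite p1 opprK.
Qed.
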